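(* Every interval $[\sigma,\tau]$ in $\mathcal{P}$ (with $\sigma\le\tau$) is rank-unimodal.
   Context: $\mathcal{S}_n$ is the set of permutations of $\{1,\dots,n\}$ in one-line notation $\tau=\tau_1\tau_2\dots\tau_n$, with $|\tau|=n$. The reduction of a sequence of $k$ distinct positive integers is the permutation in $\mathcal{S}_k$ obtained by replacing the smallest entry by $1$, the second smallest by $2$, and so on. For $1\le i\le j\le n$, $\tau_{[i,j]}\in\mathcal{S}_{j-i+1}$ is the reduction of $\tau_i\dots\tau_j$. The consecutive pattern poset $\mathcal{P}$ is the set $\bigcup_{n\ge1}\mathcal{S}_n$ with $\sigma\le\tau$ iff $\sigma=\tau_{[i,j]}$ for some $i\le j$. For $\sigma\le\tau$, the interval $[\sigma,\tau]=\{\pi:\sigma\le\pi\le\tau\}$ is graded of rank $N=|\tau|-|\sigma|$, an element $\pi$ having rank $|\pi|-|\sigma|$. A finite graded poset of rank $N$ with $a_i$ elements of rank $i$ is rank-unimodal if there exists $k$ with $0\le k\le N$ such that $a_0\le a_1\le\cdots\le a_k\ge a_{k+1}\ge\cdots\ge a_N$. *)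

(* Defs.v *)
From HB Require Import structures.
From mathcomp Require Import all_boot all_order all_fingroup.
From mathcomp Require Import finmap.

Set Implicit Arguments.
Unset Strict Implicit.
Unset Printing Implicit Defensive.

Import Order.TTheory.
Local Open Scope nat_scope.

(* For s without repetition, the k-th smallest entry has exactly k entries of s
   below or equal to it. *)
Definition reduction (s : seq nat) : seq nat :=
  [seq count (fun y => y <= x) s | x <- s].

(* The entries s_i ... s_j, with positions counted from 0. *)
Definition window (i j : nat) (s : seq nat) : seq nat := drop i (take j.+1 s).

(* 'S_n acts on {0, ..., n.-1}; one-line notation uses the values 1, ..., n. *)
Definition one_line n (p : 'S_n) : seq nat := [seq (p i).+1 | i <- enum 'I_n].

(* The disjoint union of the S_n over n >= 1, with the permutations in S_n
   tagged by n.-1. *)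
Definition consperm : Type := {n : nat & 'S_n.+1}.

HB.instance Definition _ := Choice.on consperm.

Definition Consperm n (p : 'S_n.+1) : consperm := Tagged (fun n => 'S_n.+1) p.
Definition plength (t : consperm) : nat := (tag t).+1.
Definition pword (t : consperm) : seq nat := one_line (tagged t).

Definition consec_le (s t : consperm) : bool :=
  [exists i : 'I_(plength t), exists j : 'I_(plength t),
     (i <= j) && (pword s == reduction (window i j (pword t)))].

Lemma size_one_line n (p : 'S_n) : size (one_line p) = n.
Proof. by rewrite size_map size_enum_ord. Qed.

Lemma size_pword t : size (pword t) = plength t.
Proof. exact: size_one_line. Qed.

Lemma size_reduction s : size (reduction s) = size s.
Proof. by rewrite size_map. Qed.

Lemma size_window i j s : j < size s -> size (window i j s) = j.+1 - i.
Proof. by move=> ltjs; rewrite size_drop size_takel. Qed.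

Lemma one_line_inj n : injective (@one_line n).
Proof.
move=> p q /eq_in_map eq_pq; apply/permP => i.
by have [/val_inj] := eq_pq i (mem_enum _ _).
Qed.

Lemma one_line_perm n (p : 'S_n) : perm_eq (one_line p) (iota 1 n).
Proof.
have -> : iota 1 n = [seq (val i).+1 | i <- enum 'I_n].
  by rewrite (map_comp S val) val_enum_ord -(iotaDl 1 0 n).
have -> : one_line p = [seq (val i).+1 | i <- [seq p i | i <- enum 'I_n]].
  by rewrite -map_comp.
apply: perm_map; apply: uniq_perm.
- by rewrite map_inj_uniq ?enum_uniq //; apply: perm_inj.
- exact: enum_uniq.
move=> i; rewrite mem_enum; apply/mapP; exists ((p^-1)%g i).
  by rewrite mem_enum.
by rewrite permKV.
Qed.

Lemma count_leq_iota v n : v <= n -> count (fun y => y <= v) (iota 1 n) = v.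
Proof.
move=> levn; rewrite -(subnKC levn) iotaD count_cat.
rewrite (_ : count _ (iota 1 v) = v); last first.
  rewrite -[RHS](size_iota 1 v); apply/eqP; rewrite -all_count.
  by apply/allP => y; rewrite mem_iota add1n ltnS => /andP[].
rewrite (_ : count _ _ = 0) ?addn0 //; apply/eqP; rewrite -leqn0 leqNgt -has_count.
apply/hasPn => y; rewrite mem_iota => /andP[+ _].
by rewrite add1n -ltnNge.
Qed.

Lemma reduction_one_line n (p : 'S_n) : reduction (one_line p) = one_line p.
Proof.
rewrite /reduction -[RHS]map_id; apply/eq_in_map => v.
rewrite (perm_mem (one_line_perm p)) mem_iota add1n ltnS => /andP[_ levn].
by rewrite (seq.permP (one_line_perm p)) count_leq_iota.
Qed.

Lemma reduction_window i j s :
  reduction (window i j (reduction s)) = reduction (window i j s).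
Proof.
rewrite {2}/reduction /window -map_take -map_drop -/(window i j s).
have sub_ws : {subset window i j s <= s} by move=> x /mem_drop/mem_take.
rewrite /reduction -map_comp; apply/eq_in_map => x /sub_ws xs /=.
rewrite count_map; apply: eq_in_count => y /sub_ws ys /=.
have [leyx|ltxy] := leqP y x.
  by apply: sub_count => z /= lezy; apply: leq_trans leyx.
apply/negbTE; rewrite -ltnNge.
have -> : count (fun z => z <= y) s =
  count (fun z => z <= x) s + count (fun z => x < z <= y) s.
  rewrite -count_predUI [X in _ + X](_ : _ = 0) ?addn0.
    by apply: eq_count => z /=; case: (leqP z x) => //= /leq_trans->//; exact: ltnW.
  by rewrite -(count_pred0 s); apply: eq_count => z /=; case: leqP.
rewrite -[X in X < _]addn0 ltn_add2l -has_count; apply/hasP.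
by exists y; rewrite //= ltxy leqnn.
Qed.

Lemma window_window i j k l s : l < j.+1 - i ->
  window k l (window i j s) = window (i + k) (i + l) s.
Proof.
move=> ltl; rewrite /window take_drop drop_drop take_takel; last first.
  by rewrite addSn (addnC l) -ltn_subRL.
by rewrite addSn (addnC l) (addnC k).
Qed.

Lemma consec_leP s t :
  reflect (exists i j, [/\ i <= j, j < plength t &
                        pword s = reduction (window i j (pword t))])
          (consec_le s t).
Proof.
apply: (iffP existsP) => [[i /existsP[j /andP[leij /eqP e]]]|].
  by exists i, j; split.
move=> [i [j [leij ltj e]]]; exists (Ordinal (leq_ltn_trans leij ltj)).
by apply/existsP; exists (Ordinal ltj); rewrite leij e /=.
Qed.

Lemma consec_le_length s t : consec_le s t -> plength s <= plength t.
Proof.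
move=> /consec_leP[i [j [_ ltj /(congr1 size)]]].
rewrite size_reduction size_window size_pword // => ->.
exact: leq_trans (leq_subr _ _) ltj.
Qed.

Lemma consec_le_refl : reflexive consec_le.
Proof.
move=> s; apply/consec_leP; exists 0, (tag s); split=> //.
rewrite /window drop0 take_oversize ?size_pword //.
by rewrite reduction_one_line.
Qed.

Lemma consec_le_trans : transitive consec_le.
Proof.
move=> t s u /consec_leP[k [l [lekl ltl es]]] /consec_leP[i [j [leij ltj et]]].
have szt : plength t = j.+1 - i.
  by rewrite -size_pword et size_reduction size_window ?size_pword.
rewrite szt in ltl.
apply/consec_leP; exists (i + k), (i + l); split.
- by rewrite leq_add2l.
- by apply: leq_trans ltj; rewrite -ltn_subRL.
by rewrite es et reduction_window window_window ?size_pword.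
Qed.

Lemma consec_le_anti : antisymmetric consec_le.
Proof.
move=> s t /andP[st /consec_le_length lets].
have /eqP lenst : plength s == plength t by rewrite eqn_leq consec_le_length.
move: st => /consec_leP[i [j [leij ltj e]]].
have /(congr1 size) := e.
rewrite size_reduction size_window !size_pword // lenst => ej.
have i0 : i = 0.
  apply/eqP; rewrite -leqn0 leqNgt; apply/negP => i_gt0.
  have : j.+1 - i < j.+1 by rewrite ltn_subrL i_gt0.
  by rewrite -ej ltnNge ltj.
move: e; rewrite i0 /window drop0 take_oversize; last first.
  by rewrite size_pword ej leq_subr.
rewrite reduction_one_line.
case: s t lenst {lets ltj ej} => m p [n q] [/= emn]; case: n / emn q => q.
by move/one_line_inj => /= ->.
Qed.

Fact consec_display : Order.disp_t. Proof. exact: Order.Disp tt tt. Qed.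

HB.instance Definition _ :=
  Order.Le_isPOrder.Build consec_display consperm
    consec_le_refl consec_le_anti consec_le_trans.

Lemma consec_leE (s t : consperm) : (s <= t)%O = consec_le s t.
Proof. by []. Qed.

Definition perms_upto (n : nat) : seq consperm :=
  flatten [seq [seq Consperm p | p <- enum {: 'S_k.+1}] | k <- iota 0 n].

Definition interval (s t : consperm) : {fset consperm} :=
  [fset u | u in perms_upto (plength t) & (s <= u <= t)%O]%fset.

Lemma in_interval s t u : (u \in interval s t) = (s <= u <= t)%O.
Proof.
rewrite !inE /= andb_idl // => /andP[_ /consec_le_length leut].
apply/flatten_mapP; exists (tag u); first by rewrite mem_iota.
by case: u {leut} => n p; apply: map_f; rewrite mem_enum.
Qed.

(* a_i, where rk is the rank function of the finite graded poset P *)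
Definition level_size (T : choiceType) (rk : T -> nat) (P : {fset T}) (i : nat) :=
  #|` [fset x in P | rk x == i]%fset |.

Definition rank_unimodal (T : choiceType) (rk : T -> nat) (P : {fset T})
    (N : nat) : Prop :=
  exists k : nat,
    [/\ k <= N,
        forall i, i < k -> level_size rk P i <= level_size rk P i.+1
      & forall i, k <= i < N -> level_size rk P i.+1 <= level_size rk P i].

(* Main.v *)
Require Import Defs.
From mathcomp Require Import all_boot all_order.
From mathcomp Require Import perm finmap.

(** Let tau have length n. The elements of length l in [sigma, tau] are the
    patterns of the windows of length l of tau that contain sigma. Sliding the
    window along tau gives a walk: its vertices are the patterns of the windows
    of length l, and its steps are the patterns of the windows of length l + 1,
    a step leading from its pattern without the last entry to its pattern
    without the first entry. In particular a step determines its two ends, and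
    it lies above sigma as soon as one of its ends does.

    Call the length l faithful ([faithful]) if these n - l + 1 windows have
    pairwise distinct patterns and all of them contain sigma.

    - If l < n is not faithful, then at some time j the walk is either outside
      the interval or back at a vertex seen before. Send a vertex of the
      interval first visited before time j to the step by which the walk leaves
      it after that visit, and one first visited after time j to the step by
      which the walk reaches it for the first time. No vertex of the interval is
      first visited at time j itself, so this is an injection of the elements of
      length l into those of length l + 1 ([leq_card_walk],
      [card_level_unfaithful]).

    - If l is faithful, there are exactly n - l + 1 elements of length l
      ([card_level_faithful]), and l + 1 is faithful as well when l < n
      ([faithfulS]): from then on the levels shrink by one at each rank.

    The length n is faithful, so the peak can be put at the least faithful
    length. *)

Set Implicit Arguments.
Unset Strict Implicit.
Unset Printing Implicit Defensive.

Import Order.TTheory.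
Local Open Scope nat_scope.

(** * Counting the vertices and the steps of a walk *)

Section Walk.
Context {T U : choiceType}.
Variables (w : nat -> T) (e : nat -> U) (L : nat).
Variables (A : {fset T}) (B : {fset U}).

(** Each vertex in [A] gets a step of its own, since a step determines both of
    its ends. Exit steps alone would fail for a vertex where the walk stops, and
    entry steps alone for the vertex where it starts; the time [j], at which no
    vertex of [A] is new, is where one can switch from exit steps to entry
    steps. *)
Lemma leq_card_walk j :
    {in A, forall v, exists2 i, i <= L & w i = v} ->
    (forall i, i < L -> (w i \in A) || (w i.+1 \in A) -> e i \in B) ->
    (forall i k, i < L -> k < L -> e i = e k ->
       w i = w k /\ w i.+1 = w k.+1) ->
    j <= L -> (w j \in A -> exists2 i, i < j & w i = w j) ->
  #|` A| <= #|` B|.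
Proof.
move=> visitA edgeB endpoints lejL jNfirst.
pose first v := index v (mkseq w L.+1).
have first_leq i : i <= L -> first (w i) <= i.
  move=> leiL; rewrite /first -(nth_mkseq (w 0) w (n := L.+1) (i := i)) //.
  by rewrite leqNgt; apply/negP => /(before_find (w 0)); rewrite /= eqxx.
have first_in v : v \in A -> first v <= L.
  by move=> /visitA[i leiL <-]; apply: leq_trans (first_leq i leiL) _.
have w_first v : v \in A -> w (first v) = v.
  move=> vA; have [i leiL wi] := visitA v vA.
  rewrite -[in LHS](nth_mkseq (w 0) w (n := L.+1)) ?ltnS ?first_in //.
  rewrite nth_index // -wi; apply/mapP.
  by exists i; rewrite // mem_iota.
have first_neq v : v \in A -> first v != j.
  move=> vA; apply/eqP => fv; have wj : w j = v by rewrite -fv w_first.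
  have [|i ltij wi] := jNfirst; first by rewrite wj.
  have := first_leq i (leq_trans (ltnW ltij) lejL).
  by rewrite wi wj fv leqNgt ltij.
pose f v := if first v < j then e (first v) else e (first v).-1.
have late v : v \in A -> (first v < j) = false -> j < first v.
  by move=> vA /negbT; rewrite -leqNgt leq_eqVlt eq_sym (negPf (first_neq v vA)).
have pred_first v : j < first v -> (first v).-1.+1 = first v.
  by move=> ltj; rewrite prednK // (leq_ltn_trans _ ltj).
(* An exit step used before time j that was also the entry step of v would
   bring the walk to v by time j, too early for a first visit after j. *)
have mixed u v : u \in A -> v \in A -> first u < j -> j < first v ->
    e (first u) <> e (first v).-1.
  move=> uA vA ltu ltv /endpoints[].
  - exact: leq_trans lejL.
  - by rewrite pred_first // first_in.
  rewrite pred_first // (w_first v vA) => _ wv.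
  have := first_leq _ (leq_trans ltu lejL).
  by rewrite wv leqNgt (leq_ltn_trans ltu ltv).
have f_inj : {in A &, injective f}.
  move=> u v uA vA; rewrite /f.
  case: ifPn => [ltu|/negPf/(late u uA) ltu];
    case: ifPn => [ltv|/negPf/(late v vA) ltv].
  - move=> /endpoints[]; rewrite ?w_first //; exact: leq_trans lejL.
  - by move=> /mixed-/(_ uA vA ltu ltv).
  - by move=> /esym/mixed-/(_ vA uA ltv ltu).
  - move=> /endpoints[]; rewrite ?pred_first ?first_in //.
    by rewrite !w_first.
rewrite -(card_in_imfset imfset_key f_inj).
apply: fsubset_leq_card; apply/fsubsetP => _ /imfsetP[v /= vA ->].
rewrite /f; case: ifPn => [ltv|/negPf/(late v vA) ltv].
  by apply: edgeB; rewrite ?w_first ?vA //; apply: leq_trans lejL.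
by apply: edgeB; rewrite pred_first ?w_first ?vA ?orbT ?first_in.
Qed.

End Walk.

(** * Patterns of windows as elements of the poset *)

Lemma pword_inj : injective pword.
Proof.
case=> m p [n q] eq_pq; have /(congr1 size) := eq_pq.
rewrite !size_pword /plength /= => -[emn].
by case: n / emn q eq_pq => q /one_line_inj /= ->.
Qed.

Lemma nth_reduction s i :
  i < size s -> nth 0 (reduction s) i = count (fun y => y <= nth 0 s i) s.
Proof. by move=> ltis; rewrite (nth_map 0). Qed.

Lemma reduction_bounds s i : i < size s -> 0 < nth 0 (reduction s) i <= size s.
Proof.
move=> ltis; rewrite nth_reduction // count_size -has_count andbT.
by apply/hasP; exists (nth 0 s i); rewrite ?mem_nth /=.
Qed.

Lemma uniq_reduction s : uniq s -> uniq (reduction s).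
Proof.
move=> uniq_s; rewrite map_inj_in_uniq //.
suff lt_count x y : y \in s -> x < y ->
    count (fun z => z <= x) s < count (fun z => z <= y) s.
  move=> x y xs ys eq_xy; case: (ltngtP x y) => // lt_xy.
    by have := lt_count _ _ ys lt_xy; rewrite eq_xy ltnn.
  by have := lt_count _ _ xs lt_xy; rewrite eq_xy ltnn.
move=> ys lt_xy.
have -> : count (fun z => z <= y) s =
    count (fun z => z <= x) s + count (fun z => x < z <= y) s.
  rewrite -count_predUI [X in _ + X](_ : _ = 0) ?addn0.
    apply: eq_count => z /=; case: (leqP z x) => //= le_zx.
    exact: leq_trans le_zx (ltnW lt_xy).
  by rewrite -(count_pred0 s); apply: eq_count => z /=; case: leqP.
rewrite -[X in X < _]addn0 ltn_add2l -has_count.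
by apply/hasP; exists y; rewrite //= lt_xy leqnn.
Qed.

(** Made total by falling back on the identity, for words that have repetitions
    or a length other than [n.+1]. *)
Definition standardize n (s : seq nat) : consperm :=
  Consperm (insubd (1%g : 'S_n.+1)
    [ffun i : 'I_n.+1 => inord (nth 0 (reduction s) i).-1]).

Lemma pword_standardize n s :
  uniq s -> size s = n.+1 -> pword (standardize n s) = reduction s.
Proof.
move=> uniq_s size_s; pose r := reduction s.
have bounds (i : 'I_n.+1) : 0 < nth 0 r i <= n.+1.
  by have := @reduction_bounds s i; rewrite size_s => ->.
have inordK' (i : 'I_n.+1) :
    (inord (nth 0 r i).-1 : 'I_n.+1).+1 = nth 0 r i.
  have /andP[r_gt0 r_le] := bounds i.
  by rewrite inordK prednK.
pose f := [ffun i : 'I_n.+1 => inord (nth 0 r i).-1 : 'I_n.+1].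
have f_inj : injectiveb f.
  apply/injectiveP => i k; rewrite !ffunE => /(congr1 (fun i => (val i).+1)).
  rewrite /= !inordK' => /eqP.
  rewrite nth_uniq ?size_reduction ?size_s ?uniq_reduction //.
  by move=> /eqP/val_inj.
apply: (@eq_from_nth _ 0).
  by rewrite size_pword size_reduction size_s.
rewrite size_pword => i ltin; rewrite (nth_map ord0) ?size_enum_ord //.
rewrite (nth_ord_enum ord0 (Ordinal ltin)) /=.
have pval_f : pval (tagged (standardize n s)) = f by exact: insubdK.
by rewrite -pvalE pval_f ffunE inordK'.
Qed.

(** The window has [m.+1] entries, in line with the tag of an element of the
    poset being its length minus one. *)
Definition factor (t : consperm) (m i : nat) : consperm :=
  standardize m (window i (i + m) (pword t)).

Definition factors t m : seq consperm := mkseq (factor t m) (plength t - m).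

Lemma uniq_pword t : uniq (pword t).
Proof. by rewrite (perm_uniq (one_line_perm _)) iota_uniq. Qed.

Lemma pword_factor t m i :
  i + m < plength t -> pword (factor t m i) = reduction (window i (i + m) (pword t)).
Proof.
move=> ltim; apply: pword_standardize.
  by rewrite drop_uniq // take_uniq // uniq_pword.
by rewrite size_window ?size_pword // -addnS addKn.
Qed.

Lemma factor_factor t m i k l :
    i + m < plength t -> l + k <= m ->
  factor (factor t m i) k l = factor t k (i + l).
Proof.
move=> ltim lelk; apply: pword_inj.
rewrite !pword_factor // -?addnA; last first.
  by apply: leq_ltn_trans ltim; rewrite leq_add2l.
rewrite reduction_window window_window //.
by rewrite subSn ?leq_addr // addKn.
Qed.

Lemma factor_le t m i : i + m < plength t -> (factor t m i <= t)%O.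
Proof.
move=> ltim; rewrite consec_leE; apply/consec_leP; exists i, (i + m).
by split; rewrite ?leq_addr ?pword_factor.
Qed.

Lemma le_factor (s t : consperm) :
  (s <= t)%O -> exists2 i, i + tag s < plength t & factor t (tag s) i = s.
Proof.
rewrite consec_leE => /consec_leP[i [j [leij ltj es]]].
have ej : i + tag s = j.
  have /(congr1 size) := es.
  rewrite size_pword size_reduction size_window ?size_pword // subSn //.
  by move=> [->]; rewrite subnKC.
by exists i; [rewrite ej | apply: pword_inj; rewrite pword_factor ej].
Qed.

Lemma factor_left t m i :
  i + m.+1 < plength t -> factor (factor t m.+1 i) m 0 = factor t m i.
Proof. by move=> lti; rewrite factor_factor ?addn0. Qed.

Lemma factor_right t m i :
  i + m.+1 < plength t -> factor (factor t m.+1 i) m 1 = factor t m i.+1.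
Proof. by move=> lti; rewrite factor_factor ?addn1. Qed.

Lemma factor_leS t m i :
  i + m.+1 < plength t -> (factor t m i <= factor t m.+1 i)%O.
Proof. by move=> lti; rewrite -factor_left // factor_le. Qed.

Lemma factor_leSr t m i :
  i + m.+1 < plength t -> (factor t m i.+1 <= factor t m.+1 i)%O.
Proof. by move=> lti; rewrite -factor_right // factor_le. Qed.

(** * Levels of an interval *)

Section Interval.
Variables (s t : consperm).

Definition level m : {fset consperm} := [fset x in interval s t | tag x == m]%fset.

Lemma in_level m x : (x \in level m) = (s <= x <= t)%O && (tag x == m).
Proof. by rewrite inE /= inE /= in_interval. Qed.

Lemma factor_in_level m i :
  i + m < plength t -> (factor t m i \in level m) = (s <= factor t m i)%O.
Proof. by move=> lti; rewrite in_level factor_le // eqxx !andbT. Qed.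

Lemma level_factors m : {subset level m <= factors t m}.
Proof.
move=> x; rewrite in_level => /andP[/andP[_ /le_factor[i lti <-]] /eqP <-].
by apply/mapP; exists i; rewrite // mem_iota add0n ltn_subRL addnC.
Qed.

Lemma level_sizeE r :
  level_size (fun x => plength x - plength s) (interval s t) r =
  #|` level (tag s + r)|.
Proof.
congr #|` _|; apply/fsetP => x; rewrite in_level inE /= inE /= in_interval.
apply: andb_id2l => /andP[/consec_le_length le_len _].
by rewrite -(eqn_add2l (plength s)) subnKC.
Qed.

Lemma card_level_leq m : #|` level m| <= plength t - m.
Proof.
apply: leq_trans (_ : size (factors t m) <= _); last by rewrite size_mkseq.
by apply: uniq_leq_size; rewrite ?fset_uniq //; exact: level_factors.
Qed.

Definition faithful m := uniq (factors t m) && all (fun x => (s <= x)%O) (factors t m).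

Lemma faithfulP m :
  reflect ((forall i k, i + m < plength t -> k + m < plength t ->
              factor t m i = factor t m k -> i = k) /\
           forall i, i + m < plength t -> (s <= factor t m i)%O)
          (faithful m).
Proof.
apply: (iffP andP) => [[/mkseq_uniqP inj /allP le_s]|[inj le_s]]; split.
- by move=> i k lti ltk; apply: inj; rewrite inE ltn_subRL addnC.
- move=> i lti; apply/le_s/mapP; exists i => //.
  by rewrite mem_iota add0n ltn_subRL addnC.
- apply/mkseq_uniqP => i k; rewrite !inE !ltn_subRL !(addnC m); exact: inj.
apply/allP => _ /mapP[i + ->]; rewrite mem_iota add0n ltn_subRL addnC.
exact: le_s.
Qed.

(** The pattern of a longer window determines that of its initial part and lies
    above it, so both distinctness and containment of [s] carry over. *)
Lemma faithfulS m : faithful m -> faithful m.+1.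
Proof.
move=> /faithfulP[inj le_s].
have drop1 i : i + m.+1 < plength t -> i + m < plength t.
  by rewrite addnS; apply: ltnW.
apply/faithfulP; split=> [i k lti ltk eq_ik|i lti].
  by apply: inj; rewrite ?drop1 // -factor_left // eq_ik factor_left.
exact: le_trans (le_s i (drop1 i lti)) (factor_leS lti).
Qed.

Lemma card_level_faithful m : faithful m -> #|` level m| = plength t - m.
Proof.
move=> /andP[uniq_f /allP le_s]; apply/eqP; rewrite eqn_leq card_level_leq /=.
rewrite -{1}(size_mkseq (factor t m) (plength t - m)).
apply: uniq_leq_size => // x xf; have := le_s x xf.
have /mapP[i + ->] := xf; rewrite mem_iota add0n ltn_subRL addnC => lti.
by rewrite factor_in_level.
Qed.

(** The window patterns of two consecutive lengths are the vertices and the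
    steps of a walk, and a failure of [faithful] supplies the time at which no
    vertex of the level is new: a window that misses [s], or the second of two
    windows with the same pattern. *)
Lemma card_level_unfaithful m :
  m < plength t -> ~~ faithful m -> #|` level m| <= #|` level m.+1|.
Proof.
move=> ltm unfaithful.
have ltP i : (i + m < plength t) = (i <= tag t - m).
  by rewrite /plength ltnS leq_subRL // addnC.
have ltSP i : (i + m.+1 < plength t) = (i < tag t - m).
  by rewrite addnS -addSn ltP.
have [j lej jNfirst] : exists2 j, j <= tag t - m &
    factor t m j \in level m -> exists2 i, i < j & factor t m i = factor t m j.
  move: unfaithful; rewrite negb_and => /orP[/(uniqPn t)|/allPn[_ /mapP[j + ->]]].
    rewrite size_mkseq => -[i [j [ltij ltj]]].
    rewrite !nth_mkseq // ?(ltn_trans ltij) // => eq_ij.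
    by exists j; [rewrite -ltP addnC -ltn_subRL | exists i].
  rewrite mem_iota add0n ltn_subRL addnC => ltj le_s.
  by exists j; rewrite -?ltP ?factor_in_level ?(negPf le_s).
apply: (leq_card_walk (w := factor t m) (e := factor t m.+1)) lej jNfirst.
- move=> x; rewrite in_level => /andP[/andP[_ /le_factor[i + +]] /eqP tag_x].
  by rewrite tag_x ltP; exists i.
- move=> i lti; rewrite !factor_in_level ?ltP ?ltSP // 1?ltnW //.
  rewrite -ltSP in lti.
  by case/orP=> /le_trans-> //; [apply: factor_leS | apply: factor_leSr].
- move=> i k; rewrite -!ltSP => lti ltk eq_ik.
  rewrite -(factor_left lti) -(factor_right lti) eq_ik.
  by rewrite factor_left ?factor_right.
Qed.

Lemma faithful_top : (s <= t)%O -> faithful (tag t).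
Proof.
move=> le_st.
have i0 i : i + tag t < plength t -> i = 0.
  by rewrite /plength ltnS -{2}[tag t]add0n leq_add2r leqn0 => /eqP.
apply/faithfulP; split=> [i k /i0-> /i0->//|i lti].
have [k ltk et] := le_factor (lexx t).
by rewrite (i0 i lti) -(i0 k ltk) et.
Qed.

End Interval.

Theorem corollary5p2 (sigma tau : consperm) (le_sigma_tau : (sigma <= tau)%O) :
  rank_unimodal (fun pi : consperm => plength pi - plength sigma)
    (interval sigma tau) (plength tau - plength sigma).
Proof.
set N := plength tau - plength sigma.
have tagN : tag sigma + N = tag tau.
  by rewrite /N /plength subSS subnKC // -ltnS; apply: consec_le_length.
have faithfulN : faithful sigma tau (tag sigma + N).
  by rewrite tagN faithful_top.
have ex_faithful : exists r, faithful sigma tau (tag sigma + r) by exists N.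
case: (ex_minnP ex_faithful) => k faithful_k min_k.
have lekN : k <= N by apply: min_k.
exists k; split=> // i.
  move=> ltik; rewrite !level_sizeE addnS card_level_unfaithful //.
    by rewrite /plength ltnS -tagN leq_add2l (leq_trans (ltnW ltik)).
  by apply/negP => /min_k; rewrite leqNgt ltik.
case/andP=> leki _; rewrite !level_sizeE addnS.
have faithful_i : faithful sigma tau (tag sigma + i).
  rewrite -(subnKC leki) addnA.
  by elim: (i - k) => [|d IHd]; rewrite ?addn0 // addnS faithfulS.
by rewrite !card_level_faithful ?faithfulS // subnS leq_pred.
Qed.
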